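(* Let $\mathcal{M}=(T,S,P,Q,\langle,\rangle_T,\langle,\rangle_S,I,J)$ be a unital Morita context. Then $${}_I\mathcal{C}\subseteq{}_I\mathfrak{D}\subseteq\mathrm{Gen}({}_TP).$$ Assume moreover that $\mathbf{P}_r:=(Q,P_S)$ satisfies the right $\alpha$-condition over $S$. Then: (1) $\mathrm{Gen}({}_TP)=\mathrm{Stat}^l({}_TP_S)\subseteq{}_I\mathfrak{F}$. (2) If $\mathrm{Gen}({}_TP)\subseteq{}_I\mathcal{C}$, then ${}_I\mathcal{C}={}_I\mathfrak{D}=\mathrm{Gen}({}_TP)=\mathrm{Stat}^l({}_TP_S)$. (3) If $\mathbf{Q}_r:=(P,Q_T)$ satisfies the right $\alpha$-condition over $T$, then $I_T\subseteq T_T$ is pure (i.e. $I\otimes_TK\to K$ is injective for every left $T$-module $K$) and ${}_I\mathcal{C}={}_I\mathfrak{D}$.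
   Context: All rings are associative with unity and all modules unitary. A unital Morita context $(T,S,P,Q,\langle,\rangle_T,\langle,\rangle_S,I,J)$ consists of rings $T,S$, a $(T,S)$-bimodule $P$, an $(S,T)$-bimodule $Q$, a $(T,T)$-bilinear map $\langle,\rangle_T:P\otimes_SQ\to T$ with image $I$ and an $(S,S)$-bilinear map $\langle,\rangle_S:Q\otimes_TP\to S$ with image $J$, such that $\langle q,p\rangle_Sq'=q\langle p,q'\rangle_T$ and $p\langle q,p'\rangle_S=\langle p,q\rangle_Tp'$ for all $p,p'\in P$, $q,q'\in Q$. $\mathbf{P}_r=(Q,P_S)$ satisfies the right $\alpha$-condition over $S$ if for every left $S$-module $U$ the map $P\otimes_SU\to\mathrm{Hom}_{S}(Q,U)$, $p\otimes u\mapsto[q\mapsto\langle q,p\rangle_Su]$, is injective. $\mathbf{Q}_r=(P,Q_T)$ satisfies the right $\alpha$-condition over $T$ if for every left $T$-module $U$ the map $Q\otimes_TU\to\mathrm{Hom}_{T}(P,U)$, $q\otimes u\mapsto[p\mapsto\langle p,q\rangle_Tu]$, is injective. Classes of left $T$-modules: $\mathrm{Gen}({}_TP)$ = modules that are epimorphic images of direct sums $P^{(\Lambda)}$; $\mathrm{Stat}^l({}_TP_S)$ = modules $K$ for which evaluation $P\otimes_S\mathrm{Hom}_T(P,K)\to K$ is an isomorphism; ${}_I\mathfrak{D}$ = modules $U$ with $IU=U$; ${}_I\mathfrak{F}$ = modules $U$ for which $U\to\mathrm{Hom}_T(I,U)$, $u\mapsto[t\mapsto tu]$, is injective; ${}_I\mathcal{C}$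 = modules $U$ for which the multiplication map $I\otimes_TU\to U$ is an isomorphism. *)

(* Defs.v *)
From HB Require Import structures.
From mathcomp Require Import all_boot all_order all_algebra ring_quotient.
From mathcomp Require Import freeg.
From mathcomp Require Import all_classical.

Set Implicit Arguments.
Unset Strict Implicit.
Unset Printing Implicit Defensive.

Import GRing.Theory.
Local Open Scope ring_scope.
Local Open Scope quotient_scope.

Reserved Notation "x *:> a" (at level 40, left associativity).
Reserved Notation "P ⊗ U" (at level 40, left associativity).
Reserved Notation "x ⊗t y" (at level 40, left associativity).

(* [pzRingType] rather than [nzRingType]: the zero ring is an associative ring
   with unity. *)
HB.mixin Record Zmodule_isRmodule (S : pzRingType) M of GRing.Zmodule M := {
  rscale : M -> S -> M;
  rscaleA : forall x a b, rscale (rscale x a) b = rscale x (a * b);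
  rscale1 : forall x, rscale x 1 = x;
  rscaleDl : forall a, {morph rscale^~ a : x y / x + y};
  rscaleDr : forall x, {morph rscale x : a b / a + b}
}.

#[short(type="rmodType")]
HB.structure Definition Rmodule (S : pzRingType) :=
  {M of Zmodule_isRmodule S M & GRing.Zmodule M}.

Notation "x *:> a" := (rscale x a) : ring_scope.

HB.mixin Record Lmodule_Rmodule_isBimodule (T S : pzRingType) M
    of GRing.Lmodule T M & Rmodule S M := {
  lrscaleA : forall (t : T) (x : M) (s : S), (t *: x) *:> s = t *: (x *:> s)
}.

#[short(type="bimodType")]
HB.structure Definition Bimodule (T S : pzRingType) :=
  {M of Lmodule_Rmodule_isBimodule T S M & GRing.Lmodule T M & Rmodule S M}.

HB.mixin Record isRlinear (S : pzRingType) (U V : rmodType S) (f : U -> V) := {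
  rlinearZ : forall x a, f (x *:> a) = f x *:> a
}.

#[short(type="bimodHom")]
HB.structure Definition BimodHom (T S : pzRingType) (U V : bimodType T S) :=
  {f of @isRlinear S U V f & @GRing.Linear T U V *:%R f}.

Section RegularBimodule.
Variable R : pzRingType.

HB.instance Definition _ := @Zmodule_isRmodule.Build R R^o
  (fun x a => (x : R) * a) (fun x a b => esym (mulrA (x : R) a b))
  (@mulr1 R) (fun a x y => mulrDl (x : R) y a) (fun x a b => mulrDr (x : R) a b).

HB.instance Definition _ := @Lmodule_Rmodule_isBimodule.Build R R R^o
  (fun t x s => esym (mulrA t (x : R) s)).

End RegularBimodule.

Section Image.
Variables (T S : pzRingType) (B C : bimodType T S) (f : bimodHom B C).

Definition im_pred : {pred C} := [pred y | `[< exists x, f x = y >]].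

Lemma im_submod_closed : submod_closed im_pred.
Proof.
split=> [|a u v]; rewrite !inE; first by exists 0; rewrite raddf0.
move=> [x <-] [y <-].
by exists (a *: x + y); rewrite linearP.
Qed.

HB.instance Definition _ := @GRing.isSubmodClosed.Build T C im_pred
  im_submod_closed.

Definition bimod_im := {y : C | y \in im_pred}.

HB.instance Definition _ := SubChoice.on bimod_im.
HB.instance Definition _ := [SubChoice_isSubLmodule of bimod_im by <:].

Lemma im_rscale_subproof (y : bimod_im) (a : S) : (val y *:> a) \in im_pred.
Proof.
case: y => _ /= /asboolP[x <-]; apply/asboolP.
by exists (x *:> a); rewrite rlinearZ.
Qed.

Definition im_rscale (y : bimod_im) (a : S) : bimod_im :=
  exist _ (val y *:> a) (im_rscale_subproof y a).

Lemma im_rscaleA x a b :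
  im_rscale (im_rscale x a) b = im_rscale x (a * b).
Proof. by apply: val_inj; rewrite /= rscaleA. Qed.

Lemma im_rscale1 x : im_rscale x 1 = x.
Proof. by apply: val_inj; rewrite /= rscale1. Qed.

Lemma im_rscaleDl a : {morph im_rscale^~ a : x y / x + y}.
Proof. by move=> x y; apply: val_inj; rewrite /= rscaleDl. Qed.

Lemma im_rscaleDr x : {morph im_rscale x : a b / a + b}.
Proof. by move=> a b; apply: val_inj; rewrite /= rscaleDr. Qed.

HB.instance Definition _ := Zmodule_isRmodule.Build S bimod_im
  im_rscaleA im_rscale1 im_rscaleDl im_rscaleDr.

Lemma im_lrscaleA (t : T) (x : bimod_im) (s : S) : (t *: x) *:> s = t *: (x *:> s).
Proof. by apply: val_inj; rewrite /= lrscaleA. Qed.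

HB.instance Definition _ := Lmodule_Rmodule_isBimodule.Build T S bimod_im
  im_lrscaleA.

End Image.

Section Tensor.
Variables (S : pzRingType) (P : rmodType S) (U : lmodType S).

Local Notation free := {freeg (P * U)%type / int}.

(* the subgroup generated by the defining relations of [P ⊗ U] *)
Inductive tensor_rel : free -> Prop :=
| TensorRel0 : tensor_rel 0
| TensorRelB x y : tensor_rel x -> tensor_rel y -> tensor_rel (x - y)
| TensorRelDl p p' u :
    tensor_rel (<< (p + p', u) >> - << (p, u) >> - << (p', u) >>)
| TensorRelDr p u u' :
    tensor_rel (<< (p, u + u') >> - << (p, u) >> - << (p, u') >>)
| TensorRelZ p s u : tensor_rel (<< (p *:> s, u) >> - << (p, s *: u) >>).

Definition tensor_pred : {pred free} := [pred x | `[< tensor_rel x >]].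

Lemma tensor_zmod_closed : zmod_closed tensor_pred.
Proof.
split=> [|x y]; rewrite !inE; first exact: TensorRel0.
exact: TensorRelB.
Qed.

HB.instance Definition _ := GRing.isZmodClosed.Build free tensor_pred
  tensor_zmod_closed.

Definition tensor := Quotient.quot tensor_pred.

HB.instance Definition _ := GRing.Zmodule.on tensor.

Definition tensor_pure (p : P) (u : U) : tensor := \pi_tensor << (p, u) >>.

End Tensor.

Notation "P ⊗ U" := (tensor P U) : type_scope.
Notation "p ⊗t u" := (tensor_pure p u) : ring_scope.

Section TensorLift.
Variables (S : pzRingType) (P : rmodType S) (U : lmodType S).

Lemma tensor_eqE (x y : {freeg (P * U)%type / int}) :
  tensor_rel (x - y) -> \pi_(P ⊗ U) x = \pi_(P ⊗ U) y.
Proof. by move=> h; apply/eqP; rewrite -Quotient.idealrBE; apply/asboolP. Qed.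

Lemma tensor_pureDl (p p' : P) (u : U) :
  (p + p') ⊗t u = p ⊗t u + p' ⊗t u.
Proof.
rewrite /tensor_pure -raddfD; apply: tensor_eqE.
rewrite opprD addrA; exact: TensorRelDl.
Qed.

Lemma tensor_pureDr (p : P) (u u' : U) :
  p ⊗t (u + u') = p ⊗t u + p ⊗t u'.
Proof.
rewrite /tensor_pure -raddfD; apply: tensor_eqE.
rewrite opprD addrA; exact: TensorRelDr.
Qed.

Lemma tensor_pureZ (p : P) (s : S) (u : U) : (p *:> s) ⊗t u = p ⊗t (s *: u).
Proof. by apply: tensor_eqE; exact: TensorRelZ. Qed.

Record balanced (A : zmodType) := Balanced {
  balanced_fun :> P -> U -> A;
  balancedDl : forall u, {morph balanced_fun^~ u : p p' / p + p'};
  balancedDr : forall p, {morph balanced_fun p : u u' / u + u'};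
  balancedZ : forall p s u, balanced_fun (p *:> s) u = balanced_fun p (s *: u)
}.

Variables (A : zmodType) (f : balanced A).

(* [zmodule A] is [A] with its canonical [int]-module structure *)
Definition tensor_free_lift : {freeg (P * U)%type / int} -> A :=
  fglift (fun x : P * U => f x.1 x.2 : zmodule A).

Lemma tensor_free_liftB : {morph tensor_free_lift : x y / x - y}.
Proof. exact: (@lift_is_additive int (P * U)%type (zmodule A) _). Qed.

Lemma tensor_free_liftU p u : tensor_free_lift << (p, u) >> = f p u.
Proof. by rewrite /tensor_free_lift liftU scale1r. Qed.

Lemma tensor_free_lift_rel x : tensor_rel x -> tensor_free_lift x = 0.
Proof.
have l0 : tensor_free_lift 0 = 0.
  by rewrite -[X in tensor_free_lift X](subrr 0) tensor_free_liftB subrr.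
elim=> // [{}x y _ hx _ hy|p p' u|p u u'|p s u];
  rewrite !tensor_free_liftB ?tensor_free_liftU.
- by rewrite hx hy subrr.
- by rewrite balancedDl addrAC addrK subrr.
- by rewrite balancedDr addrAC addrK subrr.
- by rewrite balancedZ subrr.
Qed.

Definition tensor_lift (x : P ⊗ U) : A := tensor_free_lift (repr x).

Lemma tensor_lift_pi x : tensor_lift (\pi_(P ⊗ U) x) = tensor_free_lift x.
Proof.
apply/eqP; rewrite -subr_eq0 -tensor_free_liftB tensor_free_lift_rel//.
suff: repr (\pi_(P ⊗ U) x) - x \in @tensor_pred S P U by rewrite inE.
by rewrite Quotient.idealrBE reprK.
Qed.

Lemma tensor_lift_is_additive : {morph tensor_lift : x y / x - y}.
Proof.
move=> x y; rewrite -[x]reprK -[y]reprK -raddfB !tensor_lift_pi.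
exact: tensor_free_liftB.
Qed.

HB.instance Definition _ := GRing.isZmodMorphism.Build (P ⊗ U) A tensor_lift
  tensor_lift_is_additive.

Lemma tensor_liftE p u : tensor_lift (p ⊗t u) = f p u.
Proof. by rewrite tensor_lift_pi tensor_free_liftU. Qed.

Lemma tensor_ind (K : P ⊗ U -> Prop) :
  (forall p u, K (p ⊗t u)) -> K 0 -> (forall x y, K x -> K y -> K (x - y)) ->
  forall x, K x.
Proof.
move=> Kp K0 KB x.
have KN y : K y -> K (- y) by rewrite -sub0r; exact: KB.
have KD y z : K y -> K z -> K (y + z).
  by move=> hy hz; rewrite -[z]opprK; apply/KB/KN.
rewrite -[x]reprK -[repr x]freeg_sumE raddf_sum.
elim/big_ind: _ => // -[p u] _; set c := coeff _ _.
have Kn n : K (\pi_(P ⊗ U) << n%:Z *g (p, u) >>).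
  elim: n => [|n IH]; first by rewrite freegU0 raddf0.
  by rewrite -addn1 PoszD -freegUD raddfD; apply: KD => //; exact: Kp.
case: c => n; first exact: Kn.
by rewrite NegzE -freegUN raddfN; apply/KN/Kn.
Qed.

End TensorLift.

Section TensorMorphEq.
Variables (S : pzRingType) (P : rmodType S) (U : lmodType S) (A : zmodType).

Lemma tensor_morph_eq (f g : {additive P ⊗ U -> A}) :
  (forall p u, f (p ⊗t u) = g (p ⊗t u)) -> f =1 g.
Proof.
move=> fg; elim/tensor_ind => // [|x y fgx fgy]; first by rewrite !raddf0.
by rewrite !raddfB fgx fgy.
Qed.

End TensorMorphEq.

Section TensorLmodule.
Variables (T S : pzRingType) (P : bimodType T S) (U : lmodType S).

Section Act.
Variable t : T.

Definition tensor_lact_balanced : @balanced S P U (P ⊗ U).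
Proof.
apply: (@Balanced _ _ _ _ (fun p u => (t *: p) ⊗t u)) => [u p p'|p u u'|p s u].
- by rewrite scalerDr tensor_pureDl.
- by rewrite tensor_pureDr.
- by rewrite -lrscaleA tensor_pureZ.
Defined.

Definition tensor_lact : P ⊗ U -> P ⊗ U := tensor_lift tensor_lact_balanced.

HB.instance Definition _ :=
  GRing.Additive.copy tensor_lact (tensor_lift tensor_lact_balanced).

Lemma tensor_lactE p u : tensor_lact (p ⊗t u) = (t *: p) ⊗t u.
Proof. exact: tensor_liftE. Qed.

End Act.

Lemma tensor_lactA a b x :
  tensor_lact a (tensor_lact b x) = tensor_lact (a * b) x.
Proof.
elim/tensor_ind: x => [p u||x y hx hy]; last by rewrite !raddfB /= hx hy.
  by rewrite !tensor_lactE scalerA.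
by rewrite !raddf0.
Qed.

Lemma tensor_lact1 : left_id 1 tensor_lact.
Proof.
elim/tensor_ind => [p u||x y hx hy]; last by rewrite raddfB /= hx hy.
  by rewrite tensor_lactE scale1r.
by rewrite raddf0.
Qed.

Lemma tensor_lactDr : right_distributive tensor_lact +%R.
Proof. by move=> t x y; rewrite raddfD. Qed.

Lemma tensor_lactDl x : {morph tensor_lact^~ x : a b / a + b}.
Proof.
move=> a b; elim/tensor_ind: x => [p u||x y hx hy].
- by rewrite !tensor_lactE scalerDl tensor_pureDl.
- by rewrite !raddf0 addr0.
- by rewrite !raddfB /= hx hy opprD addrACA.
Qed.

HB.instance Definition _ := GRing.Zmodule_isLmodule.Build T (P ⊗ U)
  tensor_lactA tensor_lact1 tensor_lactDr tensor_lactDl.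

Lemma tensor_scaleE (t : T) (p : P) (u : U) : t *: (p ⊗t u) = (t *: p) ⊗t u.
Proof. exact: tensor_lactE. Qed.

End TensorLmodule.

Section TensorRmodule.
Variables (S R : pzRingType) (P : rmodType S) (U : bimodType S R).

Section Act.
Variable r : R.

Definition tensor_ract_balanced : @balanced S P U (P ⊗ U).
Proof.
apply: (@Balanced _ _ _ _ (fun p u => p ⊗t (u *:> r))) => [u p p'|p u u'|p s u].
- by rewrite tensor_pureDl.
- by rewrite rscaleDl tensor_pureDr.
- by rewrite lrscaleA tensor_pureZ.
Defined.

Definition tensor_ract : P ⊗ U -> P ⊗ U := tensor_lift tensor_ract_balanced.

HB.instance Definition _ :=
  GRing.Additive.copy tensor_ract (tensor_lift tensor_ract_balanced).

Lemma tensor_ractE p u : tensor_ract (p ⊗t u) = p ⊗t (u *:> r).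
Proof. exact: tensor_liftE. Qed.

End Act.

Definition tensor_rscale (x : P ⊗ U) (r : R) := tensor_ract r x.

Lemma tensor_rscaleA x a b :
  tensor_rscale (tensor_rscale x a) b = tensor_rscale x (a * b).
Proof.
rewrite /tensor_rscale; elim/tensor_ind: x => [p u||x y hx hy].
- by rewrite !tensor_ractE rscaleA.
- by rewrite !raddf0.
- by rewrite !raddfB /= hx hy.
Qed.

Lemma tensor_rscale1 x : tensor_rscale x 1 = x.
Proof.
rewrite /tensor_rscale; elim/tensor_ind: x => [p u||x y hx hy].
- by rewrite tensor_ractE rscale1.
- by rewrite raddf0.
- by rewrite raddfB /= hx hy.
Qed.

Lemma tensor_rscaleDl a : {morph tensor_rscale^~ a : x y / x + y}.
Proof. by move=> x y; rewrite /tensor_rscale raddfD. Qed.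

Lemma tensor_rscaleDr x : {morph tensor_rscale x : a b / a + b}.
Proof.
move=> a b; rewrite /tensor_rscale; elim/tensor_ind: x => [p u||x y hx hy].
- by rewrite !tensor_ractE rscaleDr tensor_pureDr.
- by rewrite !raddf0 addr0.
- by rewrite !raddfB /= hx hy opprD addrACA.
Qed.

HB.instance Definition _ := Zmodule_isRmodule.Build R (P ⊗ U)
  tensor_rscaleA tensor_rscale1 tensor_rscaleDl tensor_rscaleDr.

Lemma tensor_rscaleE (p : P) (u : U) (r : R) : (p ⊗t u) *:> r = p ⊗t (u *:> r).
Proof. exact: tensor_ractE. Qed.

End TensorRmodule.

Section TensorBimodule.
Variables (T S R : pzRingType) (P : bimodType T S) (U : bimodType S R).

Lemma tensor_lrscaleA (t : T) (x : P ⊗ U) (r : R) :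
  (t *: x) *:> r = t *: (x *:> r).
Proof.
rewrite -[LHS]/(tensor_ract r (tensor_lact t x)).
rewrite -[RHS]/(tensor_lact t (tensor_ract r x)).
elim/tensor_ind: x => [p u||x y hx hy].
- by rewrite tensor_lactE !tensor_ractE tensor_lactE.
- by rewrite !raddf0.
- by rewrite !raddfB /= hx hy.
Qed.

HB.instance Definition _ := Lmodule_Rmodule_isBimodule.Build T R (P ⊗ U)
  tensor_lrscaleA.

End TensorBimodule.

Section Hom.
Variables (T : pzRingType) (U V : lmodType T).

Definition lhom := {linear U -> V}.

HB.instance Definition _ := gen_eqMixin lhom.
HB.instance Definition _ := gen_choiceMixin lhom.

Implicit Types f g h : lhom.

Lemma lhom_eqP f g : f =1 g -> f = g.
Proof.
case: f g => f [[Df] [Zf]] [g [[Dg] [Zg]]] /= /funext fg.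
rewrite fg in Df Zf *; congr (GRing.Linear.Pack (GRing.Linear.Class _ _)).
  by congr (GRing.isNmodMorphism.Axioms_ _); apply: Prop_irrelevance.
by congr (GRing.isScalable.Axioms_ _); apply: Prop_irrelevance.
Qed.

Definition lhom_zero : lhom := \0%R.
Definition lhom_opp f : lhom := \- f.
Definition lhom_add f g : lhom := f \+ g.

Lemma lhom_addA : associative lhom_add.
Proof. by move=> f g h; apply: lhom_eqP => x /=; rewrite addrA. Qed.

Lemma lhom_addC : commutative lhom_add.
Proof. by move=> f g; apply: lhom_eqP => x /=; rewrite addrC. Qed.

Lemma lhom_add0 : left_id lhom_zero lhom_add.
Proof. by move=> f; apply: lhom_eqP => x /=; rewrite add0r. Qed.

Lemma lhom_addN : left_inverse lhom_zero lhom_opp lhom_add.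
Proof. by move=> f; apply: lhom_eqP => x /=; rewrite addNr. Qed.

HB.instance Definition _ := GRing.isZmodule.Build lhom
  lhom_addA lhom_addC lhom_add0 lhom_addN.

End Hom.

Section HomLmodule.
Variables (T S : pzRingType) (P : bimodType T S) (K : lmodType T).

Section Scale.
Variables (s : S) (f : lhom P K).

(* the left [S]-module structure on [Hom_T(P, K)] induced by the right action of
   [S] on [P] *)
Definition lhom_scale_fun (p : P) : K := f (p *:> s).

Lemma lhom_scale_is_linear : linear lhom_scale_fun.
Proof. by move=> a x y; rewrite /lhom_scale_fun rscaleDl lrscaleA linearP. Qed.

HB.instance Definition _ := GRing.isLinear.Build T P K *:%R lhom_scale_fun
  lhom_scale_is_linear.

Definition lhom_scale : lhom P K := lhom_scale_fun.

End Scale.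

Lemma lhom_scaleA a b f : lhom_scale a (lhom_scale b f) = lhom_scale (a * b) f.
Proof.
by apply: lhom_eqP => x; rewrite /= /lhom_scale_fun /= /lhom_scale_fun rscaleA.
Qed.

Lemma lhom_scale1 : left_id 1 lhom_scale.
Proof. by move=> f; apply: lhom_eqP => x; rewrite /= /lhom_scale_fun rscale1. Qed.

Lemma lhom_scaleDr : right_distributive lhom_scale +%R.
Proof. by move=> a f g; apply: lhom_eqP. Qed.

Lemma lhom_scaleDl f : {morph lhom_scale^~ f : a b / a + b}.
Proof.
by move=> a b; apply: lhom_eqP => x; rewrite /= /lhom_scale_fun rscaleDr raddfD.
Qed.

HB.instance Definition _ := GRing.Zmodule_isLmodule.Build S (lhom P K)
  lhom_scaleA lhom_scale1 lhom_scaleDr lhom_scaleDl.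

End HomLmodule.

Section DirectSum.
Variables (T : pzRingType) (L : Type) (P : lmodType T).

Definition finsupp_pred : {pred L -> P} :=
  [pred f | `[< finite_set [set l | f l <> 0] >]].

Lemma finsupp_submod_closed : submod_closed finsupp_pred.
Proof.
split=> [|a f g]; rewrite !inE.
  rewrite (_ : mkset _ = set0)//.
  by apply/seteqP; split => l /= [].
move=> hf hg.
apply: (@sub_finite_set _ _ ([set l | f l <> 0] `|` [set l | g l <> 0])%classic).
  move=> l /= afg; have [f0|/eqP] := eqVneq (f l) 0; last by left.
  by right => g0; apply: afg; rewrite /GRing.add/= /GRing.scale/= f0 g0 scaler0 addr0.
by rewrite finite_setU.
Qed.

HB.instance Definition _ := GRing.isSubmodClosed.Build T (L -> P)
  finsupp_pred finsupp_submod_closed.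

(* [P^(L)], as the finitely supported functions [L -> P] *)
Definition dirsum := {f : L -> P | f \in finsupp_pred}.

HB.instance Definition _ := SubChoice.on dirsum.
HB.instance Definition _ := [SubChoice_isSubLmodule of dirsum by <:].

End DirectSum.

Record moritaContext (T S : pzRingType) := MoritaContext {
  mcP : bimodType T S;
  mcQ : bimodType S T;
  mcT : bimodHom (mcP ⊗ mcQ) T^o;
  mcS : bimodHom (mcQ ⊗ mcP) S^o;
  mcSTA : forall (q : mcQ) (p : mcP) (q' : mcQ),
    (mcS (q ⊗t p) : S) *: q' = q *:> (mcT (p ⊗t q') : T);
  mcTSA : forall (p : mcP) (q : mcQ) (p' : mcP),
    p *:> (mcS (q ⊗t p') : S) = (mcT (p ⊗t q) : T) *: p'
}.

(* The ideals I and J are images, hence determined by the two pairings. *)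
Definition mcI (T S : pzRingType) (M : moritaContext T S) : bimodType T T :=
  bimod_im (mcT M).

Definition mcJ (T S : pzRingType) (M : moritaContext T S) : bimodType S S :=
  bimod_im (mcS M).

Section Alpha.
Variables (R S : pzRingType) (V : bimodType S R) (W : bimodType R S).
Variable b : bimodHom (V ⊗ W) S^o.
Variable U : lmodType S.

Section Map.
Variables (w : W) (u : U).

Definition alpha_fun (v : V) : U := (b (v ⊗t w) : S) *: u.

Lemma alpha_fun_is_linear : linear alpha_fun.
Proof.
move=> a x y; rewrite /alpha_fun tensor_pureDl -tensor_scaleE linearP.
by rewrite scalerDl scalerA.
Qed.

HB.instance Definition _ := GRing.isLinear.Build S V U *:%R alpha_fun
  alpha_fun_is_linear.

Definition alpha_hom : lhom V U := alpha_fun.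

End Map.

Definition alpha_balanced : @balanced S W U (lhom V U).
Proof.
apply: (@Balanced _ _ _ _ alpha_hom) => [u w w'|w u u'|w s u];
  apply: lhom_eqP => v; rewrite /= /alpha_fun.
- by rewrite tensor_pureDr raddfD scalerDl.
- by rewrite scalerDr.
- by rewrite -tensor_rscaleE rlinearZ scalerA.
Defined.

Definition alpha_map : W ⊗ U -> lhom V U := tensor_lift alpha_balanced.

End Alpha.

(* The condition on the pair (V, W_S) paired by [b]: injectivity of
   [W ⊗_S U -> Hom_S(V, U)], [w ⊗ u |-> (v |-> b (v ⊗ w) u)]. *)
Definition right_alpha_condition (R S : pzRingType) (V : bimodType S R)
    (W : bimodType R S) (b : bimodHom (V ⊗ W) S^o) : Prop :=
  forall U : lmodType S, injective (alpha_map b (U := U)).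

Definition Gen (T : pzRingType) (P K : lmodType T) : Prop :=
  exists (L : Type) (f : {linear dirsum L P -> K}), forall k, exists x, f x = k.

Section Stat.
Variables (T S : pzRingType) (P : bimodType T S) (K : lmodType T).

Definition eval_balanced : @balanced S P (lhom P K) K.
Proof.
by apply: (@Balanced _ _ _ _ (fun p (f : lhom P K) => f p)) => // f p p';
  rewrite raddfD.
Defined.

Definition eval_map : P ⊗ lhom P K -> K := tensor_lift eval_balanced.

Lemma eval_map_is_linear : linear eval_map.
Proof.
move=> a x y; rewrite /eval_map raddfD; congr (_ + _).
elim/tensor_ind: x => [p f||{}x {}y hx hy].
- by rewrite tensor_scaleE /= !tensor_liftE /= linearZ.
- by rewrite /= !raddf0.
- by rewrite scalerBr /= !raddfB /= hx hy.
Qed.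

HB.instance Definition _ := GRing.isLinear.Build T (P ⊗ lhom P K) K *:%R eval_map
  eval_map_is_linear.

(* [eval_map] is linear, so it is an isomorphism exactly when it is bijective *)
Definition Stat : Prop := bijective eval_map.

End Stat.

Section IdealClasses.
Variables (T S : pzRingType) (M : moritaContext T S) (U : lmodType T).
Local Notation I := (mcI M).

Definition ival (t : I) : T := (val t : T^o).

Definition mult_balanced : @balanced T I U U.
Proof.
apply: (@Balanced _ _ _ _ (fun (t : I) (u : U) => ival t *: u))
  => [u t t'|t u u'|t s u].
- by rewrite -scalerDl.
- by rewrite scalerDr.
- by rewrite scalerA.
Defined.

Definition mult_map : I ⊗ U -> U := tensor_lift mult_balanced.

Lemma mult_map_is_linear : linear mult_map.
Proof.
move=> a x y; rewrite /mult_map raddfD; congr (_ + _).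
elim/tensor_ind: x => [t u||{}x {}y hx hy].
- by rewrite tensor_scaleE /= !tensor_liftE /= scalerA.
- by rewrite /= !raddf0.
- by rewrite scalerBr /= !raddfB /= hx hy.
Qed.

HB.instance Definition _ := GRing.isLinear.Build T (I ⊗ U) U *:%R mult_map
  mult_map_is_linear.

Section ActHom.
Variable u : U.

Definition act_fun (t : I) : U := ival t *: u.

Lemma act_fun_is_linear : linear act_fun.
Proof. by move=> a x y; rewrite /act_fun scalerA -scalerDl. Qed.

HB.instance Definition _ := GRing.isLinear.Build T I U *:%R act_fun
  act_fun_is_linear.

Definition act_hom : lhom I U := act_fun.

End ActHom.

(* as for [Stat], [mult_map] is linear *)
Definition classC : Prop := bijective mult_map.

Definition ideal_mul : set U :=
  [set u | exists s : seq (I * U), u = \sum_(x <- s) ival x.1 *: x.2]%classic.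

Definition classD : Prop := ideal_mul = [set: U]%classic.

Definition classF : Prop := injective act_hom.

End IdealClasses.

Definition ideal_pure (T S : pzRingType) (M : moritaContext T S) : Prop :=
  forall K : lmodType T, injective (mult_map (M := M) (U := K)).

(* Main.v *)
From HB Require Import structures.
Require Import Defs.
From mathcomp Require Import all_boot all_algebra finmap.
From mathcomp Require Import all_classical.

(* Everything is read off from the evaluation map [ev : P ⊗ Hom(P, K) -> K] and
   the multiplication map [mu : I ⊗ K -> K]. [Gen] and [classD] say that [ev],
   resp. [mu], is surjective, and [<p, q> k] is the value at [p] of the morphism
   [<-, q> k], so [classD] is contained in [Gen]. The α-condition for [(Q, P)]
   enters through two identities for its map [α]:
     [α x q p = <p, q> ev x]            for [x] in [P ⊗ Hom(P, K)],
     [α x q = q ⊗ mu (φ x)]             for [x] in [P ⊗ (Q ⊗ K)],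
   where [φ : P ⊗ (Q ⊗ K) -> I ⊗ K] is the natural surjection. By the first, [x]
   vanishes as soon as [I] kills [ev x], which gives injectivity of [ev] and
   [classF]; by the second, [mu] is injective. *)

Set Implicit Arguments.
Unset Strict Implicit.
Unset Printing Implicit Defensive.

Import GRing.Theory.
Local Open Scope ring_scope.

(** * Surjections and bijections *)

Definition surj (A B : Type) (f : A -> B) := forall y, exists x, f x = y.

Lemma inj_surj_bij (A B : Type) (f : A -> B) :
  injective f -> surj f -> bijective f.
Proof.
move=> finj /choice[g gK]; exists g => // x.
by apply: finj; rewrite gK.
Qed.

Lemma bij_surj (A B : Type) (f : A -> B) : bijective f -> surj f.
Proof. by case=> g _ gK y; exists (g y). Qed.

(** * Direct sums: elements concentrated at one index *)

Section Single.
Variables (T : pzRingType) (L : Type) (P : lmodType T).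

Section Def.
Variables (l : L) (p : P).

Definition single_fun (i : L) : P := if `[< i = l >] then p else 0.

Lemma single_finsupp : single_fun \in @finsupp_pred T L P.
Proof.
rewrite inE; apply: (@sub_finite_set _ _ [set l]%classic) => // i /=.
by rewrite /single_fun; case: asboolP.
Qed.

Definition single : dirsum L P := exist _ single_fun single_finsupp.

End Def.

Lemma single_linear l : linear (single l).
Proof.
move=> a x y; apply/val_inj/funext => i; rewrite /single_fun /=.
rewrite /GRing.add/= /GRing.scale/= /single_fun.
by case: ifP; rewrite // scaler0 addr0.
Qed.

HB.instance Definition _ l := GRing.isLinear.Build T P (dirsum L P) *:%R
  (single l) (single_linear l).

Lemma dirsum_ind (K : dirsum L P -> Prop) :
  (forall l p, K (single l p)) -> K 0 -> (forall x y, K x -> K y -> K (x + y)) ->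
  forall x, K x.
Proof.
move=> Ks K0 KD x.
(* [L] is an arbitrary type; [{classic L}] equips it with the equality needed to list the support
   and induct on that list. *)
have /finite_seqP[s sE] :
    finite_set ([set l | val x l <> 0] : set {classic L})%classic.
  by have := valP x; rewrite inE.
have {sE} : forall l : {classic L}, val x l <> 0 -> l \in s.
  by move=> l xl; suff : [set` s]%classic l by []; rewrite -sE.
elim: s x => [|l s IH] x xs.
  rewrite (_ : x = 0)//; apply/val_inj/funext => l /=.
  by apply: contrapT => /xs.
(* Removing the component at [l] leaves an element supported in [s]. *)
rewrite -[x](subrK (single l (val x l))); apply: KD => //.
apply: IH => i /=; rewrite /GRing.add/= /GRing.opp/= /single_fun.
case: asboolP => [->|il]; first by rewrite subrr.
by rewrite subr0 => /xs; rewrite inE => /orP[/eqP|].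
Qed.

End Single.

(** * Direct sums: the morphism induced by a family *)

Section Sum.
Variables (T : pzRingType) (L : choiceType) (P K : lmodType T).
Variable phi : L -> lhom P K.

Definition dirsum_lift (x : dirsum L P) : K :=
  \sum_(l \in [set: L]%classic) phi l (val x l).

(** Any finite set containing the support will do, so that several elements can be summed over one
    common set. *)
Lemma dirsum_liftE (A : {fset L}) x :
  (forall l, val x l <> 0 -> l \in A) ->
  dirsum_lift x = \sum_(l <- A) phi l (val x l).
Proof.
move=> xA; rewrite /dirsum_lift -(@fsbig_widen _ _ _ _ [set` A]%classic) //.
  by rewrite fsbig_finite ?set_fsetK//; exact: finite_fset.
move=> l [_ /= lA]; suff -> : val x l = 0 by rewrite raddf0.
by apply: contrapT => /xA.
Qed.

Lemma dirsum_lift_linear : linear dirsum_lift.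
Proof.
move=> a x y.
have fin (z : dirsum L P) : exists A : {fset L}, forall l, val z l <> 0 -> l \in A.
  have /finite_fsetP[A AE] : finite_set [set l | val z l <> 0]%classic.
    by have := valP z; rewrite inE.
  by exists A => l zl; suff : [set` A]%classic l by []; rewrite -AE.
have [[A xA] [B yB]] := (fin x, fin y).
(* [A] and [B] contain the supports of [x] and [y], so their union also contains that of
   [a *: x + y]. *)
rewrite !(@dirsum_liftE (A `|` B)%fset).
- rewrite scaler_sumr -big_split /=; apply: eq_bigr => l _.
  exact: (linearP (phi l) a (val x l) (val y l)).
- by move=> l /yB; rewrite inE => ->; rewrite orbT.
- by move=> l /xA; rewrite inE => ->.
move=> l xyl; rewrite inE; apply/orP; apply: contrapT => /not_orP[lA lB].
apply: xyl; rewrite -[LHS]/(a *: val x l + val y l).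
have -> : val x l = 0 by apply: contrapT => /xA.
have -> : val y l = 0 by apply: contrapT => /yB.
by rewrite scaler0 addr0.
Qed.

HB.instance Definition _ := GRing.isLinear.Build T (dirsum L P) K *:%R
  dirsum_lift dirsum_lift_linear.

Lemma dirsum_lift_single l p : dirsum_lift (single l p) = phi l p.
Proof.
rewrite (@dirsum_liftE [fset l]%fset) ?big_seq_fset1 /= /single_fun.
  by case: asboolP.
by move=> i; case: asboolP => // -> _; rewrite inE.
Qed.

End Sum.

(** * Additivity of pure tensors *)

Section TensorPure.
Variables (S : pzRingType) (P : rmodType S) (U : lmodType S).

Lemma tensor_pure_is_additive (p : P) :
  {morph @tensor_pure S P U p : u v / u - v}.
Proof.
by move=> u v; apply/eqP; rewrite eq_sym subr_eq -tensor_pureDr subrK.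
Qed.

HB.instance Definition _ p := GRing.isZmodMorphism.Build U (P ⊗ U)
  (tensor_pure p) (tensor_pure_is_additive p).

Lemma tensor_pureBl (p p' : P) (u : U) : (p - p') ⊗t u = p ⊗t u - p' ⊗t u.
Proof. by apply/eqP; rewrite eq_sym subr_eq -tensor_pureDl subrK. Qed.

Lemma tensor_pure0l (u : U) : (0 : P) ⊗t u = 0.
Proof. by rewrite -(subrr (0 : P)) tensor_pureBl subrr. Qed.

End TensorPure.

(** * Generation by [P] as surjectivity of evaluation *)

Section EvalSurj.
Variables (T S : pzRingType) (P : bimodType T S) (K : lmodType T).
Local Notation ev := (eval_map (P := P) (K := K)).

Lemma eval_mapE p f : ev (p ⊗t f) = f p.
Proof. exact: tensor_liftE. Qed.

(** A morphism from a direct sum restricts to a morphism [P -> K] on each summand, so its values are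
    sums of values of such morphisms. *)
Lemma Gen_eval_surj : Gen P K <-> surj ev.
Proof.
split=> [[L [f fsurj]] k|evsurj].
  have [x <-] := fsurj k; elim/dirsum_ind: x => [l p||x y [u ux] [v vy]].
  - by exists (p ⊗t (f \o single l : lhom P K)); rewrite eval_mapE.
  - by exists 0; rewrite !raddf0.
  - by exists (u + v); rewrite !raddfD /= ux vy.
(* One copy of [P] for each morphism [P -> K], on which that morphism acts. *)
exists (lhom P K), (dirsum_lift (fun l : lhom P K => l)) => k.
have [x <-] := evsurj k; elim/tensor_ind: x => [p f||x y [u ux] [v vy]].
- by exists (single f p); rewrite eval_mapE; exact: dirsum_lift_single.
- by exists 0; rewrite !raddf0.
- by exists (u - v); rewrite !raddfB /= ux vy.
Qed.

End EvalSurj.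

(** * The map of the α-condition *)

Section AlphaMap.
Variables (R S : pzRingType) (V : bimodType S R) (W : bimodType R S).
Variables (b : bimodHom (V ⊗ W) S^o) (U : lmodType S).

HB.instance Definition _ := GRing.Additive.copy (alpha_map b (U := U))
  (tensor_lift (alpha_balanced b U)).

Lemma alpha_mapE (w : W) (u : U) (v : V) : alpha_map b (w ⊗t u) v = (b (v ⊗t w) : S) *: u.
Proof. by rewrite /alpha_map tensor_liftE. Qed.

End AlphaMap.

(** * Evaluation and multiplication in a Morita context *)

Section Morita.
Variables (T S : pzRingType) (M : moritaContext T S) (K : lmodType T).
Local Notation P := (mcP M).
Local Notation Q := (mcQ M).
Local Notation I := (mcI M).
Local Notation ev := (eval_map (P := P) (K := K)).
Local Notation mu := (mult_map (M := M) (U := K)).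

Lemma mult_mapE t k : mu (t ⊗t k) = ival t *: k.
Proof. exact: tensor_liftE. Qed.

Lemma classD_mult_surj : classD M K <-> surj mu.
Proof.
split=> [DK k|musurj].
  have : @ideal_mul T S M K k by rewrite DK.
  case=> s ->; exists (\sum_(x <- s) x.1 ⊗t x.2).
  by rewrite raddf_sum; apply: eq_bigr => x _; rewrite /= mult_mapE.
apply/seteqP; split=> k // _; have [x <-] := musurj k.
elim/tensor_ind: x => [t u||x y [s sE] [s' s'E]].
- by exists [:: (t, u)]; rewrite big_seq1 mult_mapE.
- by exists [::]; rewrite big_nil raddf0.
(* The induction on tensors runs over differences; the sign is absorbed by the factor in [I]. *)
- exists (s ++ [seq (- x.1, x.2) | x <- s']); rewrite raddfB big_cat big_map.
  rewrite /= sE s'E; congr (_ + _); rewrite -sumrN.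
  apply: eq_bigr => z _.
  by rewrite -scaleNr.
Qed.

(** The pairing into [T] with its codomain restricted to the image [I]. *)
Definition imI (x : P ⊗ Q) : I :=
  exist _ (mcT M x) (asboolT (ex_intro _ x erefl)).

Lemma imI_is_additive : {morph imI : x y / x - y}.
Proof. by move=> x y; apply: val_inj; rewrite /= raddfB. Qed.

Lemma ival_is_additive : {morph @ival T S M : x y / x - y}.
Proof. by []. Qed.

HB.instance Definition _ := GRing.isZmodMorphism.Build I T (@ival T S M)
  ival_is_additive.

HB.instance Definition _ := GRing.isZmodMorphism.Build (P ⊗ Q) I imI
  imI_is_additive.

Lemma imI_surj : surj imI.
Proof.
move=> t; have /asboolP[x xt] := valP t; exists x; exact: val_inj.
Qed.

Lemma classD_eval_surj : classD M K -> surj ev.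
Proof.
move=> /classD_mult_surj musurj k; have [x <-] := musurj k.
elim/tensor_ind: x => [t u||x y [v vx] [w wy]].
- have [x <-] := imI_surj t; elim/tensor_ind: x => [p q||x y [v vx] [w wy]].
  (* [alpha_hom (mcT M) q u] is the morphism [<-, q> u] from [P] to [K]. *)
  + by exists (p ⊗t alpha_hom (mcT M) q u); rewrite eval_mapE mult_mapE.
  + by exists 0; rewrite mult_mapE !raddf0 scale0r.
  + by exists (v - w); rewrite mult_mapE !raddfB /= vx wy !mult_mapE scalerBl.
- by exists 0; rewrite !raddf0.
- by exists (v - w); rewrite !raddfB /= vx wy.
Qed.

Lemma alpha_eval (x : P ⊗ lhom P K) q p :
  (alpha_map (mcS M) x q : lhom P K) p = (mcT M (p ⊗t q) : T) *: ev x.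
Proof.
elim/tensor_ind: x => [p' f||x y hx hy].
- rewrite alpha_mapE eval_mapE.
  by rewrite -[LHS]/(f (p *:> _)) mcTSA linearZ.
- by rewrite [alpha_map _ _]raddf0 [ev _]raddf0 scaler0.
- by rewrite [alpha_map _ _]raddfB [ev _]raddfB scalerBr -hx -hy.
Qed.

Hypothesis alphaP : right_alpha_condition (mcS M).

Lemma eval_ker (x : P ⊗ lhom P K) :
  (forall t : I, ival t *: ev x = 0) -> x = 0.
Proof.
move=> x0; apply: (alphaP (U := lhom P K)); apply: lhom_eqP => q.
apply: lhom_eqP => p; rewrite alpha_eval.
have := x0 (imI (p ⊗t q)); rewrite /ival /= => ->.
by rewrite raddf0.
Qed.

Lemma eval_inj : injective ev.
Proof.
by apply: raddf_inj => x x0; apply: eval_ker => t; rewrite x0 scaler0.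
Qed.

Lemma Gen_Stat : Gen P K <-> Stat P K.
Proof.
split=> [/Gen_eval_surj|/bij_surj /Gen_eval_surj //].
exact/inj_surj_bij/eval_inj.
Qed.

Lemma Stat_classF : Stat P K -> classF M K.
Proof.
move=> /bij_surj evsurj u v uv.
apply/eqP; rewrite -subr_eq0; apply/eqP.
have [x xE] := evsurj (u - v); rewrite -xE (@eval_ker x) ?raddf0// => t.
rewrite xE scalerBr; apply/eqP; rewrite subr_eq0; apply/eqP.
exact: (congr1 (fun f : lhom I K => f t) uv).
Qed.

(** First stage of φ, with [p] fixed; balancedness over [T] is the right [T]-linearity of the
    pairing. *)
Definition imI_tensor_balanced (p : P) : @balanced T Q K (I ⊗ K).
Proof.
apply: (@Balanced _ _ _ _ (fun q k => imI (p ⊗t q) ⊗t k))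
  => [k q q'|q k k'|q t k].
- by rewrite tensor_pureDr raddfD tensor_pureDl.
- by rewrite tensor_pureDr.
- rewrite -tensor_pureZ; congr (_ ⊗t _); apply: val_inj => /=.
  by rewrite -tensor_rscaleE rlinearZ.
Defined.

(** Second stage of φ, letting [p] vary: it amounts to reassociating to [(P ⊗ Q) ⊗ K] and applying
    [imI] to the first factor. *)
Definition assoc_balanced : @balanced S P (Q ⊗ K) (I ⊗ K).
Proof.
apply: (@Balanced _ _ _ _ (fun p => tensor_lift (imI_tensor_balanced p)))
  => [x p p'|p x x'|p s x].
- elim/tensor_ind: x => [q k||x y hx hy].
  + by rewrite !tensor_liftE /= tensor_pureDl raddfD tensor_pureDl.
  + by rewrite !raddf0 addr0.
  + by rewrite !raddfB /= hx hy opprD addrACA.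
- by rewrite raddfD.
- elim/tensor_ind: x => [q k||x y hx hy].
  + by rewrite tensor_scaleE !tensor_liftE /= tensor_pureZ.
  + by rewrite scaler0 !raddf0.
  + by rewrite scalerBr !raddfB /= hx hy.
Defined.

Definition imI_tensor : P ⊗ (Q ⊗ K) -> I ⊗ K := tensor_lift assoc_balanced.

HB.instance Definition _ :=
  GRing.Additive.copy imI_tensor (tensor_lift assoc_balanced).

Lemma imI_tensorE p q k : imI_tensor (p ⊗t (q ⊗t k)) = imI (p ⊗t q) ⊗t k.
Proof. by rewrite /imI_tensor tensor_liftE /= tensor_liftE. Qed.

Lemma imI_tensor_surj : surj imI_tensor.
Proof.
elim/tensor_ind => [t k||_ _ [u <-] [v <-]].
- have [x <-] := imI_surj t; elim/tensor_ind: x => [p q||x y [u ux] [v vy]].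
  + by exists (p ⊗t (q ⊗t k)); rewrite imI_tensorE.
  + by exists 0; rewrite !raddf0 tensor_pure0l.
  + by exists (u - v); rewrite !raddfB /= tensor_pureBl ux vy.
- by exists 0; rewrite raddf0.
- by exists (u - v); rewrite raddfB.
Qed.

Lemma alpha_imI_tensor (x : P ⊗ (Q ⊗ K)) q :
  alpha_map (mcS M) x q = q ⊗t mu (imI_tensor x).
Proof.
elim/tensor_ind: x => [p y||x y hx hy].
- rewrite alpha_mapE; elim/tensor_ind: y => [q' k||x y hx hy].
  (* [<q, p> q' ⊗ k = q <p, q'> ⊗ k = q ⊗ <p, q'> k]. *)
  + by rewrite imI_tensorE mult_mapE tensor_scaleE mcSTA tensor_pureZ.
  + by rewrite scaler0 !raddf0.
  + by rewrite scalerBr hx hy !raddfB.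
- by rewrite !raddf0.
- by rewrite [alpha_map _ _]raddfB !raddfB /= -hx -hy.
Qed.

Lemma mult_inj : injective mu.
Proof.
apply: raddf_inj => y; have [x <-] := imI_tensor_surj y => x0.
(* It suffices that the chosen preimage [x] of [y] vanishes, and the α-condition for the module
   [Q ⊗ K] detects this. *)
rewrite (_ : x = 0) ?raddf0//; apply: (alphaP (U := Q ⊗ K)).
by apply: lhom_eqP => q; rewrite alpha_imI_tensor x0 raddf0 raddf0.
Qed.

End Morita.

Theorem theorem6p3 (T S : pzRingType) (M : moritaContext T S) :
  (forall K : lmodType T, classC M K -> classD M K) /\
  (forall K : lmodType T, classD M K -> Gen (mcP M) K) /\
  (right_alpha_condition (mcS M) ->
    [/\ (forall K : lmodType T, Gen (mcP M) K <-> Stat (mcP M) K) /\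
        (forall K : lmodType T, Stat (mcP M) K -> classF M K),
        (forall K : lmodType T, Gen (mcP M) K -> classC M K) ->
          [/\ forall K : lmodType T, classC M K <-> classD M K,
              forall K : lmodType T, classD M K <-> Gen (mcP M) K
            & forall K : lmodType T, Gen (mcP M) K <-> Stat (mcP M) K]
      & right_alpha_condition (mcT M) ->
          ideal_pure M /\
          (forall K : lmodType T, classC M K <-> classD M K)]).
Proof.
have CD K : classC M K -> classD M K by move/bij_surj/classD_mult_surj.
have DG K : classD M K -> Gen (mcP M) K.
  by move/classD_eval_surj/Gen_eval_surj.
split=> //; split=> // alphaP; split.
- by split=> K; [exact: Gen_Stat | exact: Stat_classF].
(* The assumption closes the chain [classC], [classD], [Gen] into a cycle of inclusions. *)
- move=> GC; split=> K; last exact: Gen_Stat.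
  + by split=> [/CD|/DG/GC].
  + by split=> [/DG|/GC/CD].
- move=> _; split=> K; first exact: mult_inj.
  split=> [/CD //|/classD_mult_surj].
  exact/inj_surj_bij/mult_inj.
Qed.
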